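(* If $A$ is an $n\times n$ (entrywise) nonnegative matrix with $\|A\|_{\max}\le 1$, then equality holds in the inequality $$\|A\|_{*}\le \frac{n\sqrt n}{2}+\frac n2$$ (which is valid for every such $A$) if and only if the matrix $H:=2A-J_n$ is a regular Hadamard matrix.
   Context: For a matrix $A=[a_{i,j}]$, $\|A\|_{\max}:=\max_{i,j}|a_{i,j}|$, and $\|A\|_*$ (the trace norm) is the sum of the singular values of $A$. $J_n$ is the $n\times n$ all-ones matrix. An Hadamard matrix of order $n$ is an $n\times n$ matrix $H$ with entries of modulus $1$ such that $HH^*=nI_n$, where $H^*$ is the conjugate transpose of $H$ and $I_n$ is the identity matrix of order $n$. A matrix is called regular if its row sums are equal, and so are its column sums.
   Formalization: The ''if'' direction additionally requires the row sums of H to be positive, since without this it fails: for n=1, A=(0), H=(-1) is a regular Hadamard matrix but the trace norm of A is 0, below the bound 1. *)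

(* Defs.v *)
From mathcomp Require Import all_boot all_order all_algebra.
From mathcomp Require Import spectral complex.
From mathcomp Require Import reals matrix_normedtype.

Set Implicit Arguments.
Unset Strict Implicit.
Unset Printing Implicit Defensive.

Import Order.TTheory GRing.Theory Num.Theory.
Local Open Scope ring_scope.
Local Open Scope sesquilinear_scope.

(* [A ^t* *m A] is Hermitian, hence normal, so [spectral_diag] lists its
   eigenvalues with multiplicity (see [orthomx_spectralP]); they are
   nonnegative, and [sqrtC] of a nonnegative number is its nonnegative root. *)
Definition singular_value (C : numClosedFieldType) m n (A : 'M[C]_(m, n))
    (i : 'I_n) : C :=
  sqrtC (spectral_diag (A ^t* *m A) 0 i).

Definition trace_norm (C : numClosedFieldType) m n (A : 'M[C]_(m, n)) : C :=
  \sum_(i < n) singular_value A i.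

Definition hadamard (C : numClosedFieldType) n (H : 'M[C]_n) : Prop :=
  (forall i j, `|H i j| = 1) /\ H *m H ^t* = n%:R *: 1%:M.

Definition regular_mx (C : nmodType) m n (A : 'M[C]_(m, n)) : Prop :=
  (forall i i', \sum_j A i j = \sum_j A i' j) /\
  (forall j j', \sum_i A i j = \sum_i A i j').

(* Main.v *)
Require Import Defs.
From mathcomp Require Import all_boot all_order all_algebra.
From mathcomp Require Import spectral complex.
From mathcomp Require Import reals matrix_normedtype.
From mathcomp Require Import interval_inference ring.

(** Write [H = 2A - J], whose entries are real and at most 1 in modulus, and let
    [<X, Y> = tr (X* Y)].  A polar decomposition supplies a contraction [U] with
    [<U, A> = ||A||_*] ([polar_contraction]), so that

      [2 ||A||_* = <U, H> + <U, J>].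

    Both terms are bounded by the inequality between the arithmetic and the
    geometric mean in the form [2 Re <X, Y> <= <X, X> + <Y, Y>].  With
    [X = sqrt n U] and [Y = H] it gives [Re <U, H> <= n sqrt n], as
    [<U, U> <= n] and [<H, H> <= n ^ 2].  Since [J = e e*] for the all-ones
    column [e], [<U, J> = <U e, e>], and [X = U e], [Y = e] gives
    [Re <U, J> <= n].  The sum of the two is the upper bound.  The identity
    [deficit] keeps every term that these estimates drop, so equality forces
    [H = sqrt n U] with [U] unitary and [U e = e]: [H] is Hadamard with all row
    and column sums equal to [sqrt n] ([trace_norm_le_hadamard]).

    Conversely, let [H] be regular and Hadamard with positive row sums.  Counting
    [e* H H* e] in two ways shows that the row sums are [sqrt n].  Then
    [U = H / sqrt n] is unitary and [<U, A> = (n sqrt n + n) / 2], while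
    [Re <U, A> <= ||A||_*] for every unitary [U] ([trace_norm_dual]); hence the
    upper bound is attained ([trace_norm_regular_hadamard]). *)

Set Implicit Arguments.
Unset Strict Implicit.
Unset Printing Implicit Defensive.

Import Order.TTheory GRing.Theory Num.Theory.
Local Open Scope ring_scope.
Local Open Scope sesquilinear_scope.

(** * The Hilbert-Schmidt inner product *)

(** The Hilbert-Schmidt (Frobenius) inner product, conjugate-linear in [X]. *)
Definition hs (C : numClosedFieldType) m n (X Y : 'M[C]_(m, n)) : C :=
  \tr (X ^t* *m Y).

Lemma hs_sum (C : numClosedFieldType) m n (X Y : 'M[C]_(m, n)) :
  hs X Y = \sum_j \sum_i (X i j)^* * Y i j.
Proof. by apply: eq_bigr => j _; rewrite mxE; apply: eq_bigr => i _; rewrite !mxE. Qed.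

Lemma adjM (C : numClosedFieldType) m n p (X : 'M[C]_(m, n)) (Y : 'M[C]_(n, p)) :
  (X *m Y) ^t* = Y ^t* *m X ^t*.
Proof. by rewrite trmx_mul map_mxM. Qed.

Lemma adjB (C : numClosedFieldType) m n (X Y : 'M[C]_(m, n)) :
  (X - Y) ^t* = X ^t* - Y ^t*.
Proof. by rewrite linearB /= map_mxB. Qed.

Lemma adjZ (C : numClosedFieldType) m n a (X : 'M[C]_(m, n)) :
  (a *: X) ^t* = a^* *: X ^t*.
Proof. by rewrite linearZ /= map_mxZ. Qed.

Lemma gram_diag_ge0 (C : numClosedFieldType) m n (X : 'M[C]_(m, n)) j :
  0 <= (X ^t* *m X) j j.
Proof.
by rewrite mxE sumr_ge0 // => i _; rewrite !mxE mulrC mul_conjC_ge0.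
Qed.

Lemma hs_ge0 (C : numClosedFieldType) m n (X : 'M[C]_(m, n)) : 0 <= hs X X.
Proof. by apply: sumr_ge0 => j _; apply: gram_diag_ge0. Qed.

Lemma hs_eq0 (C : numClosedFieldType) m n (X : 'M[C]_(m, n)) :
  hs X X = 0 -> X = 0.
Proof.
rewrite hs_sum => /eqP; rewrite psumr_eq0; last first.
  by move=> j _; apply: sumr_ge0 => i _; rewrite mulrC mul_conjC_ge0.
move=> /allP X0; apply/matrixP => i j; rewrite mxE.
have := X0 j (mem_index_enum _); rewrite psumr_eq0; last first.
  by move=> k _; rewrite mulrC mul_conjC_ge0.
move=> /allP /(_ i (mem_index_enum _)).
by rewrite mulrC mul_conjC_eq0 => /eqP.
Qed.

Lemma hsC (C : numClosedFieldType) m n (X Y : 'M[C]_(m, n)) :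
  (hs X Y)^* = hs Y X.
Proof.
rewrite !hs_sum rmorph_sum; apply: eq_bigr => j _.
rewrite rmorph_sum; apply: eq_bigr => i _.
by rewrite rmorphM /= conjCK mulrC.
Qed.

Lemma hsBr (C : numClosedFieldType) m n (X Y Z : 'M[C]_(m, n)) :
  hs X (Y - Z) = hs X Y - hs X Z.
Proof. by rewrite /hs mulmxBr linearB. Qed.

Lemma hsBl (C : numClosedFieldType) m n (X Y Z : 'M[C]_(m, n)) :
  hs (X - Y) Z = hs X Z - hs Y Z.
Proof. by rewrite /hs adjB mulmxBl linearB. Qed.

Lemma hsZr (C : numClosedFieldType) m n a (X Y : 'M[C]_(m, n)) :
  hs X (a *: Y) = a * hs X Y.
Proof. by rewrite /hs -scalemxAr linearZ. Qed.

Lemma hsZl (C : numClosedFieldType) m n a (X Y : 'M[C]_(m, n)) :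
  hs (a *: X) Y = a^* * hs X Y.
Proof. by rewrite /hs adjZ -scalemxAl linearZ. Qed.

Lemma hs_mulmxr (C : numClosedFieldType) m n p
    (X : 'M[C]_(m, n)) (Y : 'M[C]_(m, p)) (Z : 'M[C]_(p, n)) :
  hs X (Y *m Z) = hs (X *m Z ^t*) Y.
Proof. by rewrite /hs adjM trmxCK mulmxA mxtrace_mulC mulmxA. Qed.

Lemma ones_outer (C : numClosedFieldType) m n :
  const_mx 1 = (const_mx 1 : 'cV[C]_m) *m (const_mx 1 : 'cV[C]_n) ^t*.
Proof.
by apply/matrixP => i j; rewrite [RHS]mxE big_ord1 !mxE /= rmorph1 mulr1.
Qed.

Lemma hs_ones (C : numClosedFieldType) n :
  hs (const_mx 1 : 'cV[C]_n) (const_mx 1) = n%:R.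
Proof.
rewrite hs_sum big_ord1 -[in RHS](card_ord n) -sumr_const; apply: eq_bigr => i _.
by rewrite !mxE rmorph1 mulr1.
Qed.

Lemma hs_dist (C : numClosedFieldType) m n (X Y : 'M[C]_(m, n)) :
  hs (X - Y) (X - Y) = hs X X - (hs X Y + hs Y X) + hs Y Y.
Proof. by rewrite hsBl !hsBr; ring. Qed.

Lemma hs_normr (C : numClosedFieldType) m n (X : 'M[C]_(m, n)) :
  hs X X = \sum_j \sum_i `|X i j| ^+ 2.
Proof.
by rewrite hs_sum; apply: eq_bigr => j _; apply: eq_bigr => i _; rewrite normCK mulrC.
Qed.

Lemma sum_ones2 (C : numClosedFieldType) n :
  n%:R ^+ 2 = \sum_(j < n) \sum_(i < n) 1 :> C.
Proof. by rewrite !(sumr_const, card_ord) -mulrnA mulnn natrX. Qed.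

Lemma hs_le_sq (C : numClosedFieldType) n (H : 'M[C]_n) :
  (forall i j, `|H i j| <= 1) -> hs H H <= n%:R ^+ 2.
Proof.
move=> H1; rewrite hs_normr sum_ones2; apply: ler_sum => j _.
by apply: ler_sum => i _; rewrite expr_le1.
Qed.

Lemma hs_eq_sq (C : numClosedFieldType) n (H : 'M[C]_n) :
  (forall i j, `|H i j| <= 1) -> hs H H = n%:R ^+ 2 ->
  forall i j, `|H i j| = 1.
Proof.
move=> H1 /esym/eqP; rewrite -subr_eq0 hs_normr sum_ones2 -sumrB => S0 i j.
have sq_ge0 i' j' : 0 <= 1 - `|H i' j'| ^+ 2 by rewrite subr_ge0 expr_le1.
have := S0; under eq_bigr do rewrite -sumrB.
rewrite psumr_eq0 => [/allP /(_ j (mem_index_enum _))|j' _]; last first.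
  by rewrite sumr_ge0.
rewrite psumr_eq0 => [/allP /(_ i (mem_index_enum _))|i' _ //].
by rewrite subr_eq0 eq_sym sqrp_eq1 // => /eqP.
Qed.

(** * Singular values and the trace norm *)

(** A singular value decomposition that leaves the left factor [Q] incomplete:
    its columns are the normalized columns of [A V*] for nonzero singular values
    and vanish otherwise.  A partial isometry [Q] suffices to recover [A], and
    spares the completion to an orthonormal basis; whether it is unitary is read
    off from the singular values. *)
Lemma svd (C : numClosedFieldType) n (A : 'M[C]_n) (s := singular_value A) :
  exists Q V : 'M[C]_n,
    [/\ V \is unitarymx,
        A = Q *m diag_mx (\row_i s i) *m V,
        Q ^t* *m Q = diag_mx (\row_i (s i != 0)%:R)
      & forall i, 0 <= s i].
Proof.
set V := spectralmx (A ^t* *m A).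
have Vu : V \is unitarymx by apply: spectral_unitarymx.
have normal : A ^t* *m A \is normalmx.
  by apply/normalmxP; rewrite adjM trmxCK.
have := orthomx_spectralP normal; rewrite -/V invmx_unitary // => AA.
pose B := A *m V ^t*.
have BB : B ^t* *m B = diag_mx (spectral_diag (A ^t* *m A)).
  rewrite /B adjM trmxCK mulmxA -(mulmxA V) AA !mulmxA.
  rewrite (unitarymxP Vu) mul1mx -mulmxA (unitarymxP Vu).
  by rewrite mulmx1 -AA.
have d_ge0 i : 0 <= spectral_diag (A ^t* *m A) 0 i.
  by have := gram_diag_ge0 B i; rewrite BB mxE eqxx mulr1n.
have s_ge0 i : 0 <= s i by rewrite sqrtC_ge0.
have BBE i j : (B ^t* *m B) i j = s i ^+ 2 *+ (i == j).
  by rewrite BB mxE sqrtCK.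
(* Since [0^-1 = 0], this divides the nonzero columns of [B] by their norms and
   leaves the zero columns alone. *)
pose Q := B *m diag_mx (\row_i (s i)^-1).
have QQ : Q ^t* *m Q = diag_mx (\row_i (s i != 0)%:R).
  rewrite /Q adjM mulmxA -(mulmxA _ (B ^t*)).
  have -> : (diag_mx (\row_i (s i)^-1)) ^t* = diag_mx (\row_i (s i)^-1).
    rewrite tr_diag_mx map_diag_mx; congr diag_mx; apply/rowP => i.
    by rewrite !mxE /= geC0_conj ?invr_ge0.
  apply/matrixP => i j; rewrite mul_mx_diag mxE mul_diag_mx mxE BBE !mxE.
  case: eqVneq => [<-|_]; last by rewrite mulr0n mulr0 mul0r.
  have [->|si0] := eqVneq (s i) 0; first by rewrite invr0 !mul0r.
  by rewrite !mulr1n; field.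
have QB : Q *m diag_mx (\row_i s i) = B.
  apply/matrixP => i j; rewrite mul_mx_diag mxE /Q mul_mx_diag !mxE.
  have [sj0|sj0] := eqVneq (s j) 0; last by rewrite mulfVK.
  (* A column of [B] with zero singular value has norm zero, so nothing is lost. *)
  have := BBE j j; rewrite sj0 expr0n eqxx mul0rn mxE => /eqP.
  rewrite psumr_eq0 => [/allP /(_ i (mem_index_enum _))|k _].
    by rewrite !mxE mulrC mul_conjC_eq0 => /eqP ->; rewrite mulr0.
  by rewrite !mxE mulrC mul_conjC_ge0.
exists Q, V; split=> //.
by rewrite QB /B -mulmxA (mulmx1C (unitarymxP Vu)) mulmx1.
Qed.

Lemma trace_norm_ge0 (C : numClosedFieldType) n (A : 'M[C]_n) :
  0 <= trace_norm A.
Proof. by apply: sumr_ge0 => i _; have [? [? [_ _ _]]] := svd A; apply. Qed.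

(** The partial isometry [U] of the polar decomposition of [A].  Its norm
    [hs U U] is the rank of [A], so it is unitary as soon as that norm is [n];
    in the equality case this replaces the choice of a unitary polar factor. *)
Lemma polar_contraction (C : numClosedFieldType) n (A : 'M[C]_n) :
  exists U : 'M[C]_n,
    [/\ hs U A = trace_norm A,
        hs U U <= n%:R,
        (hs U U = n%:R -> U ^t* *m U = 1%:M)
      & forall p (X : 'M[C]_(n, p)), hs (U *m X) (U *m X) <= hs X X].
Proof.
have [Q [V [Vu AE QQ s_ge0]]] := svd A.
set s := singular_value A in AE QQ s_ge0.
set e := \row_i (s i != 0)%:R in QQ.
have hsQV X Y : hs (X *m V) (Y *m V) = hs X Y.
  by rewrite hs_mulmxr -mulmxA (unitarymxP Vu) mulmx1.
have hsUU : hs (Q *m V) (Q *m V) = \sum_i e 0 i.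
  by rewrite hsQV /hs QQ mxtrace_diag.
have e_le1 i : e 0 i <= 1 by rewrite mxE; case: (_ != _); rewrite ?ler01.
have nE : n%:R = \sum_(i < n) 1 :> C by rewrite sumr_const card_ord.
exists (Q *m V); split.
- rewrite [X in hs _ X]AE hsQV /hs mulmxA QQ mulmx_diag mxtrace_diag.
  apply: eq_bigr => i _; rewrite !mxE.
  by rewrite -/(s i); case: eqVneq => [->|_]; rewrite ?mulr0 ?mul1r.
- by rewrite hsUU nE ler_sum.
(* A sum of [n] numbers at most 1 equals [n] only if all of them are 1. *)
- rewrite hsUU => /eqP; rewrite eq_sym -subr_eq0 nE -sumrB.
  rewrite psumr_eq0 => [/allP e1|i _]; last by rewrite subr_ge0.
  have {}e1 i : e 0 i = 1.
    by apply/esym/eqP; rewrite -subr_eq0; apply: e1; rewrite mem_index_enum.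
  have -> : (Q *m V) ^t* *m (Q *m V) = V ^t* *m V.
    rewrite adjM -mulmxA (mulmxA (Q ^t*)) QQ.
    suff -> : e = const_mx 1 by rewrite diag_const_mx mul1mx.
    by apply/rowP => i; rewrite e1 mxE.
  exact: mulmx1C (unitarymxP Vu).
(* As [V] is unitary, [X] may be replaced by [V X]; then [Q] acts on norms as
   the projection [diag_mx e]. *)
- move=> p X; rewrite -[leRHS](_ : hs (V *m X) (V *m X) = _); last first.
    by rewrite /hs adjM -mulmxA (mulmxA (V ^t*)) (mulmx1C (unitarymxP Vu)) mul1mx.
  rewrite -mulmxA; move: (V *m X) => Y; rewrite /hs adjM -mulmxA (mulmxA (Q ^t*)) QQ.
  rewrite -!/(hs Y _) !hs_sum; apply: ler_sum => j _; apply: ler_sum => i _.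
  rewrite mul_diag_mx [X in _ * X <= _]mxE mulrCA.
  by rewrite ler_piMl // mulrC mul_conjC_ge0.
Qed.

(** Duality between trace norm and operator norm.  With [A = Q D V], the pairing
    [hs U A] is the sum of the singular values weighted by the inner products of
    the columns of [U V*] and [Q], and all these columns have norm at most 1.
    Twice the real part is written as [hs U A + hs A U]. *)
Lemma trace_norm_dual (C : numClosedFieldType) n (A U : 'M[C]_n) :
  U ^t* *m U = 1%:M -> hs U A + hs A U <= 2 * trace_norm A.
Proof.
move=> Uu; have [Q [V [Vu AE QQ s_ge0]]] := svd A.
set s := singular_value A in AE QQ s_ge0.
pose X := U *m V ^t*.
have XX : X ^t* *m X = 1%:M.
  rewrite /X adjM trmxCK mulmxA -(mulmxA V) Uu mulmx1; exact: unitarymxP Vu.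
have UA : hs U A = \sum_i (X ^t* *m Q) i i * s i.
  rewrite {1}AE hs_mulmxr -/X /hs mulmxA; apply: eq_bigr => i _.
  by rewrite mul_mx_diag !mxE.
have AU : hs A U = \sum_i (Q ^t* *m X) i i * s i.
  rewrite -hsC UA rmorph_sum; apply: eq_bigr => i _.
  rewrite rmorphM /= (geC0_conj (s_ge0 i)); congr (_ * _).
  by rewrite -[in RHS](trmxCK X) -adjM !mxE.
rewrite UA AU -big_split mulr_sumr; apply: ler_sum => i _ /=.
rewrite -mulrDl ler_wpM2r //.
(* The [i]-th columns [x], [q] satisfy [2 Re <x, q> <= <x, x> + <q, q> <= 2]. *)
have := gram_diag_ge0 (X - Q) i.
rewrite adjB mulmxBl !mulmxBr XX QQ.
move: (X ^t* *m Q) (Q ^t* *m X) => P P'.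
have : (s i != 0)%:R <= 1 :> C by case: (_ != _); rewrite ?ler01.
rewrite !mxE eqxx !mulr1n; move: (_%:R) => b b1 H.
rewrite -[b <= 1]subr_ge0 in b1.
rewrite -subr_ge0; apply: le_trans (addr_ge0 H b1) _.
by rewrite le_eqVlt; apply/orP; left; apply/eqP; ring.
Qed.

(** * The upper bound *)

(** All that is lost when [Re <U, H>] and [Re <U, J>] are estimated by
    completing squares.  Everything is multiplied by [r = sqrt n], as the natural
    pair of vectors in the first estimate is [r U] and [H]; the term
    [hs (e - U *m e) _] comes from [J = e e*]. *)
Lemma deficit (C : numClosedFieldType) n (A U : 'M[C]_n)
    (r := sqrtC n%:R) (H := 2 *: A - const_mx 1)
    (e := const_mx 1 : 'cV[C]_n) :
  2 * n%:R ^+ 2 + 2 * n%:R * r - 2 * r * (hs U A + hs A U) =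
    hs (r *: U - H) (r *: U - H) + n%:R * (n%:R - hs U U)
    + (n%:R ^+ 2 - hs H H)
    + r * (hs (e - U *m e) (e - U *m e)
           + (n%:R - hs (U *m e) (U *m e))).
Proof.
have rr : r ^+ 2 = n%:R by rewrite sqrtCK.
have rc : r^* = r by rewrite geC0_conj ?sqrtC_ge0 ?ler0n.
have UJ : hs U (const_mx 1) = hs (U *m e) e by rewrite ones_outer hs_mulmxr trmxCK.
have JU : hs (const_mx 1) U = hs e (U *m e) by rewrite -hsC UJ hsC.
have UH : hs U H = 2 * hs U A - hs (U *m e) e by rewrite hsBr hsZr UJ.
have HU : hs H U = 2 * hs A U - hs e (U *m e).
  by rewrite hsBl hsZl JU rmorph_nat.
rewrite !hs_dist !hsZl !hsZr rc UH HU hs_ones -rr; ring.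
Qed.

(** The bound and its equality case come from one identity, [deficit] applied to
    the contraction [U] of [polar_contraction]: four times the gap, scaled by
    [sqrt n], is a combination with positive coefficients of the nonnegative
    defects [a], [b], [c], [d], [f], so it is nonnegative, and it vanishes only
    if all defects do.  Vanishing of [b] makes [U] unitary, of [a] makes [H] a
    multiple of it, of [c] makes the entries of [H] unimodular, and of [d] makes
    the all-ones vector fixed by [U]; since [U] is unitary, that vector is then
    fixed by [U ^t*] too, which handles the column sums. *)
Lemma trace_norm_le_hadamard (C : numClosedFieldType) n (A : 'M[C]_n.+1)
    (H := 2 *: A - const_mx 1) (r := sqrtC n.+1%:R) :
  (forall i j, `|H i j| <= 1) ->
  trace_norm A <= n.+1%:R * r / 2 + n.+1%:R / 2 /\
  (trace_norm A = n.+1%:R * r / 2 + n.+1%:R / 2 ->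
   [/\ hadamard H, forall i, \sum_j H i j = r & forall j, \sum_i H i j = r]).
Proof.
move=> H_le1; have [U [UA UU_le U_unitary U_contract]] := polar_contraction A.
have AU : hs A U = trace_norm A.
  by rewrite -hsC UA geC0_conj ?trace_norm_ge0.
have := deficit A U; cbv zeta; rewrite UA AU -/H -/r.
set N : C := n.+1%:R in UU_le U_unitary *; set e : 'cV[C]_n.+1 := const_mx 1.
set a := hs (r *: U - H) _; set b := N - hs U U; set c := N ^+ 2 - hs H H.
set d := hs (e - U *m e) _; set f := N - hs (U *m e) _ => E.
have a0 : 0 <= a by apply: hs_ge0.
have b0 : 0 <= b by rewrite subr_ge0.
have c0 : 0 <= c by rewrite subr_ge0 hs_le_sq.
have d0 : 0 <= d by apply: hs_ge0.
have f0 : 0 <= f by rewrite subr_ge0 /N -(hs_ones C n.+1) U_contract.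
have N0 : 0 < N by rewrite ltr0n.
have r0 : 0 < r by rewrite sqrtC_gt0.
have rr : r ^+ 2 = N by rewrite sqrtCK.
have gapE : 4 * r * (N * r / 2 + N / 2 - trace_norm A)
            = a + N * b + c + r * (d + f).
  by rewrite -E -rr; field.
have Nb0 := mulr_ge0 (ltW N0) b0.
have rdf0 := mulr_ge0 (ltW r0) (addr_ge0 d0 f0).
split.
  rewrite -subr_ge0 -(pmulr_rge0 _ (_ : 0 < 4 * r)) ?mulr_gt0 ?ltr0n //.
  by rewrite gapE (addr_ge0 (addr_ge0 (addr_ge0 a0 Nb0) c0) rdf0).
move=> T; have /eqP : a + N * b + c + r * (d + f) = 0.
  by rewrite -gapE T subrr mulr0.
rewrite (paddr_eq0 (addr_ge0 (addr_ge0 a0 Nb0) c0) rdf0).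
rewrite (paddr_eq0 (addr_ge0 a0 Nb0) c0) (paddr_eq0 a0 Nb0) !mulf_eq0.
rewrite (gt_eqF N0) (gt_eqF r0) /= (paddr_eq0 d0 f0).
case/andP=> /andP[/andP[/eqP/hs_eq0/eqP + +] +] /andP[/eqP/hs_eq0/eqP + _].
rewrite !subr_eq0 => /eqP/esym HU /eqP/esym/U_unitary Uu /eqP/esym HHn.
move=> /eqP/esym Ue.
have rc : r^* = r by rewrite geC0_conj ?ltW.
have eU : e ^t* *m U = e ^t* by rewrite -{1}Ue adjM -mulmxA Uu mulmx1.
split; first split.
- exact: hs_eq_sq.
- rewrite HU adjZ rc -scalemxAl -scalemxAr (mulmx1C Uu) scalerA.
  by rewrite -expr2 rr.
- move=> i; have /(congr1 (fun X : 'cV_n.+1 => r * X i 0)) := Ue.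
  rewrite !mxE mulr1 => <-; rewrite mulr_sumr; apply: eq_bigr => j _.
  by rewrite HU !mxE mulr1.
- move=> j; have /(congr1 (fun X : 'rV_n.+1 => r * X 0 j)) := eU.
  rewrite !mxE /= rmorph1 mulr1 => <-; rewrite mulr_sumr; apply: eq_bigr => i _.
  by rewrite HU !mxE /= rmorph1 mul1r.
Qed.

(** * Attaining the bound *)

(** [U = H / r] is a unitary for which [hs U A] equals the bound, once the row
    sums [c] are known to be [r].  Evaluating [e* H e] from both sides identifies
    the row sums [c] and the column sums [d], and [e* (H H* ) e = n ^ 2] then
    gives [c ^ 2 = n]. *)
Lemma trace_norm_regular_hadamard (C : numClosedFieldType) n (A : 'M[C]_n.+1)
    (H := 2 *: A - const_mx 1) (r := sqrtC n.+1%:R) :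
  hadamard H -> regular_mx H -> (forall i, 0 < \sum_j H i j) ->
  n.+1%:R * r / 2 + n.+1%:R / 2 <= trace_norm A.
Proof.
move=> [_ HH] [rowH colH] posH.
set N : C := n.+1%:R in HH *.
have N0 : 0 < N by rewrite ltr0n.
have r0 : 0 < r by rewrite sqrtC_gt0.
have rr : r ^+ 2 = N by rewrite sqrtCK.
have rc : r^* = r by rewrite geC0_conj ?ltW.
pose c := \sum_j H 0 j; pose d := \sum_i H i 0.
pose e := const_mx 1 : 'cV[C]_n.+1.
have ee : e ^t* *m e = N%:M.
  by rewrite [LHS]mx11_scalar -trace_mx11 -/(hs e e) hs_ones.
have He : H *m e = c *: e.
  apply/colP => i; rewrite !mxE mulr1 /c (rowH 0 i).
  by apply: eq_bigr => j _; rewrite [X in _ * X]mxE mulr1.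
have eH : e ^t* *m H = d *: e ^t*.
  apply/rowP => j; rewrite !mxE /= rmorph1 mulr1 /d (colH 0 j).
  by apply: eq_bigr => i _; rewrite !mxE /= rmorph1 mul1r.
have N_neq0 : N != 0 by rewrite gt_eqF.
have c_gt0 : 0 < c by apply: posH.
have cd : c = d.
  have : e ^t* *m H *m e = e ^t* *m (H *m e) by rewrite mulmxA.
  rewrite eH He -scalemxAl -scalemxAr ee !scale_scalar_mx.
  by move/matrixP/(_ 0 0); rewrite !mxE eqxx !mulr1n => /(mulIf N_neq0).
have cr : c = r.
  have : e ^t* *m (H *m H ^t*) *m e = (e ^t* *m H) *m (e ^t* *m H) ^t*.
    by rewrite adjM trmxCK !mulmxA.
  rewrite HH eH -cd adjZ trmxCK -scalemxAr mulmx1 -!scalemxAl -scalemxAr ee.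
  rewrite scalerA !scale_scalar_mx => /matrixP/(_ 0 0).
  rewrite !mxE eqxx !mulr1n geC0_conj ?ltW // => /(mulIf N_neq0) NE.
  by apply/eqP; rewrite -(eqrXn2 (ltn0Sn 1)) ?ltW // rr NE expr2.
have rn0 : r != 0 by rewrite gt_eqF.
pose U := r^-1 *: H.
have Uu : U ^t* *m U = 1%:M.
  apply: mulmx1C; rewrite adjZ fmorphV /= rc -scalemxAl -scalemxAr HH !scalerA -rr.
  by rewrite (_ : _ * _ = 1) ?scale1r //; field.
have HJ : hs H (const_mx 1) = N * r.
  by rewrite ones_outer hs_mulmxr trmxCK -/e He hsZl hs_ones cr rc mulrC.
have HHs : hs H H = N ^+ 2.
  rewrite /hs mxtrace_mulC HH linearZ /= mxtrace1 expr2 //.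
have UA : hs U A = N * r / 2 + N / 2.
  have HA : 2 * hs H A - N * r = N ^+ 2 by rewrite -HHs -HJ -hsZr -hsBr.
  rewrite hsZl fmorphV /= rc.
  have -> : hs H A = (2 * hs H A - N * r + N * r) / 2 by field.
  by rewrite HA -rr; field.
have := trace_norm_dual A Uu; rewrite -(hsC U A) UA geC0_conj.
  by rewrite -(mulr2n (_ + _)) -(mulr_natl (_ + _)) ler_pM2l ?ltr0n.
by rewrite addr_ge0 ?divr_ge0 ?mulr_ge0 ?ler0n // ltW.
Qed.

(** * The equality case *)

(** The maximum is taken among the nonnegative elements of [K], on which the
    order is total. *)
Lemma mx_norm_ge (K : numDomainType) m n (A : 'M[K]_(m, n)) i j :
  `|A i j| <= mx_norm A.
Proof.
have : mx_norm A <= mx_norm A by [].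
by rewrite {1}mx_normE num_le => /bigmax_leP[_ /(_ (i, j) isT)].
Qed.

Lemma norm_2B1_le1 (C : numClosedFieldType) (a : C) :
  0 <= a <= 1 -> (2 * a - 1)^* = 2 * a - 1 /\ (2 * a - 1) ^+ 2 <= 1.
Proof.
move=> /andP[a0 a1]; split.
  by rewrite rmorphB rmorphM rmorph1 rmorph_nat /= geC0_conj.
rewrite -subr_ge0 (_ : _ - _ = 4 * (a * (1 - a))); last by ring.
by rewrite mulr_ge0 ?ler0n // mulr_ge0 ?subr_ge0.
Qed.

Local Open Scope complex_scope.

(* [0 <= z] in [R[i]] means that [z] is real and nonnegative.  The common row
   sum of a regular Hadamard matrix [2 *: A - const_mx 1] is the square root of
   [n] up to sign, and equality holds only for the positive sign: for [A = 0]
   with [n = 1], or [A = 1%:M] with [n = 4], the matrix is regular Hadamard but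
   the inequality is strict.  Hence the explicit positivity of the row sums. *)
Theorem proposition1p2 (R : realType) (n : nat) (A : 'M[R[i]]_n)
    (A_ge0 : forall i j, 0 <= A i j) (A_le1 : mx_norm A <= 1) :
  trace_norm A <= n%:R * sqrtC n%:R / 2 + n%:R / 2 /\
  (trace_norm A = n%:R * sqrtC n%:R / 2 + n%:R / 2 <->
   [/\ regular_mx (2 *: A - const_mx 1),
       hadamard (2 *: A - const_mx 1)
     & forall i, 0 < \sum_j (2 *: A - const_mx 1 : 'M[R[i]]_n) i j]).
Proof.
have H1 i j : `|(2 *: A - const_mx 1 : 'M_n) i j| <= 1.
  have A01 : 0 <= A i j <= 1.
    by rewrite A_ge0 -[A i j](ger0_norm (A_ge0 i j)) (le_trans _ A_le1) ?mx_norm_ge.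
  have [xr x1] := norm_2B1_le1 A01.
  by rewrite !mxE -(expr_le1 (n := 2)) // normCK xr -expr2.
case: n A A_ge0 A_le1 H1 => [|n] A A_ge0 A_le1 H1.
  rewrite /trace_norm big_ord0 !mul0r addr0; split=> //; split=> // _.
  by split; [split; case|split; [case|apply/matrixP; case]|case].
have [T_le T_eq] := trace_norm_le_hadamard H1.
split=> //; split=> [/T_eq[hadH row col]|[regH hadH pos]].
  split=> //; first by split=> [i i'|j j']; rewrite ?row ?col.
  by move=> i; rewrite row sqrtC_gt0 ltr0n.
by apply/eqP; rewrite eq_le T_le trace_norm_regular_hadamard.
Qed.
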